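(* Let $\mathbb{K}$ be a field with $\operatorname{char}\mathbb{K}\neq 2$, let $m\le n$ be integers with $m,n\ge 3$, and let $X=(x_{ij})$ be an $m\times n$ generic matrix over $\mathbb{K}$. Then $\operatorname{v}(P_2(X))=3$.
   Context: A generic $m\times n$ matrix over $\mathbb{K}$ is a matrix $X=(x_{ij})$ whose $mn$ entries are distinct algebraically independent indeterminates; we work in the standard graded polynomial ring $R=\mathbb{K}[x_{ij}\mid 1\le i\le m,\ 1\le j\le n]$. $P_2(X)\subseteq R$ denotes the $2\times 2$ permanental ideal of $X$: the ideal generated by all $2\times2$ subpermanents $x_{ik}x_{jl}+x_{il}x_{jk}$ with $1\le i<j\le m$, $1\le k<l\le n$. For a graded ideal $I$ of a standard graded polynomial ring $R=\bigoplus_{d\ge0}R_d$ over a field, the $\operatorname{v}$-number of $I$ is $$\operatorname{v}(I)=\min\{d\mid \text{there exist } f\in R_d \text{ and } \mathfrak{p}\in\operatorname{Ass}(I)\text{ such that } (I:f)=\mathfrak{p}\},$$ where $\operatorname{Ass}(I)$ is the set of associated primes of $R/I$ and $(I:f)=\{g\in R\mid gf\in I\}$. *)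

(* Defs.v *)
From HB Require Import structures.
From mathcomp Require Import all_boot all_order all_algebra.
From mathcomp Require Import ring_quotient.
From mathcomp Require Import mpoly.
From mathcomp Require boolp.

Set Implicit Arguments.
Unset Strict Implicit.
Unset Printing Implicit Defensive.

Import GRing.Theory.
Local Open Scope ring_scope.

Section Ideals.
Variable R : comNzRingType.

(* Ideals are boolean predicates, as in ring_quotient; membership is decided
   classically by [boolp.asbool]. *)
Definition ideal_gen (T : finType) (P : pred T) (F : T -> R) : {pred R} :=
  [pred g | boolp.asbool (exists c : T -> R, g = \sum_(t | P t) c t * F t)].

Definition colon (I : {pred R}) (f : R) : {pred R} := [pred g | g * f \in I].

(* [idealr_closed] includes [1 \notin p], so prime ideals are proper. *)
Definition prime_ideal (p : {pred R}) : Prop :=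
  idealr_closed p /\ prime_idealr_closed p.

(* The annihilator in R/I of the class of f is [colon I f]. *)
Definition associated_prime (I p : {pred R}) : Prop :=
  prime_ideal p /\ exists f : R, p =i colon I f.

End Ideals.

Section Permanental.
Variables (R : comNzRingType) (m n : nat) (X : 'M[R]_(m, n)).

Definition perm2 (i j : 'I_m) (k l : 'I_n) : R :=
  X i k * X j l + X i l * X j k.

(* An index is ((i, j), (k, l)): a pair of rows and a pair of columns. *)
Definition permanental_ideal2 : {pred R} :=
  ideal_gen (fun t : ('I_m * 'I_m) * ('I_n * 'I_n) =>
               (t.1.1 < t.1.2)%N && (t.2.1 < t.2.2)%N)
            (fun t => perm2 t.1.1 t.1.2 t.2.1 t.2.2).

End Permanental.

(* The m * n indeterminates are numbered through the bijection [mxvec_index]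
   between 'I_m * 'I_n and 'I_(m * n). *)
Definition generic_matrix (K : fieldType) (m n : nat) :
    'M[{mpoly K[m * n]}]_(m, n) :=
  \matrix_(i, j) 'X_(mxvec_index i j).

Section VNumber.
Variables (K : fieldType) (N : nat) (I : {pred {mpoly K[N]}}).

Definition v_degree (d : nat) : Prop :=
  exists (f : {mpoly K[N]}) (p : {pred {mpoly K[N]}}),
    [/\ f \is d.-homog, associated_prime I p & colon I f =i p].

(* v(I) = d. A relation, since the minimum is undefined when no degree is
   attained (e.g. for the unit ideal). *)
Definition is_vnumber (d : nat) : Prop :=
  v_degree d /\ forall d' : nat, v_degree d' -> (d <= d')%N.

End VNumber.

(* Main.v *)
(* Upper bound: for entries a1, a2, a3 of one row and b of another row, each product
   aj ak b with b in neither column j nor column k satisfies 2 aj ak b in P_2(X).  Hence the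
   colon of P_2(X) by x11 x12 x13 is the prime generated by the entries outside the first row.

   Lower bound: let (P_2(X) : f) = q be prime with deg f <= 2.  A ring morphism phi to a
   domain that kills P_2(X) but not f has kernel containing q.  If restriction to a row does
   not kill f, then q contains no entry of that row, hence all the other entries, and the
   morphisms attached to the 2x2 blocks meeting the row show that f vanishes on the row after
   all.  The same holds for columns, so f only involves products x_ik x_jl with i != j and
   k != l.  If a block morphism does not kill f, then q contains the entries outside the
   block; pairing with the signs of the 3x3 permutation monomials, a linear form that kills
   P_2(X), shows that the coefficients of x_ik x_jl and x_il x_jk agree.  So f lies in P_2(X),
   which is absurd. *)
From HB Require Import structures.
Require Import Defs.
From mathcomp Require Import all_boot all_order all_algebra all_fingroup.
From mathcomp Require Import mpoly ring zify.
From mathcomp Require boolp.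

Set Implicit Arguments.
Unset Strict Implicit.
Unset Printing Implicit Defensive.

Import GRing.Theory.
Local Open Scope ring_scope.

(** * Monomials of degree at most two *)

Section Monomials.
Variable N : nat.
Implicit Types (m : 'X_{1..N}) (u v : 'I_N) (S : pred 'I_N).

Definition mnm_in S m := [forall u, (m u != 0%N) ==> S u].

Lemma mnm_inP S m : reflect (forall u, m u != 0%N -> S u) (mnm_in S m).
Proof. exact: (iffP 'forall_implyP). Qed.

Lemma mnm1D_eq u v a b : u != v ->
  ((U_(a) + U_(b))%MM == (U_(u) + U_(v))%MM :> 'X_{1..N}) =
  ((a == u) && (b == v)) || ((a == v) && (b == u)).
Proof.
move=> uv; apply/eqP/idP => [/mnmP e|]; last first.
  by case/orP=> /andP[/eqP-> /eqP->] //; rewrite addmC.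
have vu : (v == u) = false by rewrite eq_sym (negbTE uv).
move: (e u) (e v); rewrite !mnmDE !mnm1E !eqxx vu (negbTE uv).
case: (eqVneq a u) => [->|au]; case: (eqVneq b u) => [->|bu] //=;
  rewrite ?(negbTE uv) ?andbF ?andbT //=;
  by [case: (eqVneq b v) | case: (eqVneq a v)].
Qed.

Lemma mnm_deg2 m u v : u != v -> (mdeg m <= 2)%N ->
  (forall w, m w != 0%N -> (w == u) || (w == v)) -> m u != 0%N -> m v != 0%N ->
  m = (U_(u) + U_(v))%MM.
Proof.
move=> uv; rewrite mdegE (bigD1 u) //= (bigD1 v) /=; last by rewrite eq_sym.
move=> hd hs hu hv.
have [eu ev] : m u = 1%N /\ m v = 1%N.
  by move: hd hu hv; case: (m u) (m v) => [|[|a]] [|[|b]]; lia.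
apply/mnmP => w; rewrite mnmDE !mnm1E.
case: (eqVneq u w) uv => [<- uv|uw _]; first by rewrite eq_sym (negbTE uv) eu.
case: (eqVneq v w) => [<-|vw]; first by rewrite ev.
by apply/eqP; apply: contraTT isT => /hs; rewrite ![w == _]eq_sym (negbTE uw) (negbTE vw).
Qed.

(** A third variable in the support would force degree 3. [u] and [v] may coincide; [u0] serves only
    for the constant monomial. *)
Lemma mnm_deg_le2 m u0 : (mdeg m <= 2)%N ->
  exists u v, forall w, m w != 0%N -> (w == u) || (w == v).
Proof.
move=> hd.
case: (pickP (fun w => m w != 0%N)) => [u hu|h]; last first.
  by exists u0, u0 => w; rewrite h.
case: (pickP (fun w => (m w != 0%N) && (w != u))) => [v /andP[hv vu]|h]; last first.
  by exists u, u => w hw; move: (h w); rewrite hw /= => /negbFE ->.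
exists u, v => w hw; apply: contraTT hd; rewrite negb_or => /andP[wu wv].
rewrite -ltnNge mdegE (bigD1 u) //= (bigD1 v) //= (bigD1 w) /=; last by rewrite wu wv.
by move: hu hv hw; lia.
Qed.

End Monomials.

(** * Restriction of polynomials to a set of variables *)

Section Restriction.
Variables (K : fieldType) (N : nat).
Implicit Types (p : {mpoly K[N]}) (m : 'X_{1..N}) (S : pred 'I_N).

(** Written as a substitution, it is a ring morphism; [mcoeff_restrict] shows that it keeps exactly
    the terms supported in [S]. *)
Definition restrict S : {mpoly K[N]} -> {mpoly K[N]} :=
  mmap (@mpolyC N K) (fun u => if S u then 'X_u else 0).

HB.instance Definition _ S := GRing.RMorphism.on (restrict S).

Lemma restrictU S u : restrict S 'X_u = if S u then 'X_u else 0.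
Proof. by rewrite /restrict mmapX mmap1U. Qed.

Lemma restrictX S m : restrict S 'X_[m] = if mnm_in S m then 'X_[m] else 0.
Proof.
rewrite /restrict mmapX; case: mnm_inP => [h|/mnm_inP].
  rewrite -mmap1_id /mmap1; apply: eq_bigr => u _.
  by have [->|/h ->] := eqVneq (m u) 0%N; rewrite ?expr0.
rewrite negb_forall => /existsP[u]; rewrite negb_imply => /andP[mu Su].
by rewrite /mmap1 (bigD1 u) //= (negbTE Su) expr0n (negbTE mu) mul0r.
Qed.

Lemma mcoeff_restrict S p m :
  (restrict S p)@_m = if mnm_in S m then p@_m else 0.
Proof.
rewrite /restrict /mmap raddf_sum [p in RHS]mpolyE raddf_sum /=.
have -> : (if mnm_in S m then \sum_(k <- msupp p) (p@_k *: 'X_[k])@_m else 0) =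
    \sum_(k <- msupp p) (if mnm_in S m then (p@_k *: 'X_[k])@_m else 0).
  by case: ifP => // _; rewrite big1.
apply: eq_bigr => k _.
rewrite -(mmapX _ (@mpolyC N K)) -/(restrict S _) restrictX mcoeffCM mcoeffZ mcoeffX.
case: (eqVneq k m) => [->|km]; last first.
  by rewrite mulr0 if_same; case: ifP; rewrite ?mcoeff0 ?mcoeffX ?(negbTE km) mulr0.
by case: ifP => _; rewrite ?mcoeffX ?eqxx ?mcoeff0 ?mulr0.
Qed.


End Restriction.

Lemma restrict_mmap (K : fieldType) (N : nat) (S : pred 'I_N)
    (h : 'I_N -> {mpoly K[N]}) p :
  restrict S (mmap (@mpolyC N K) h p) = mmap (@mpolyC N K) (restrict S \o h) p.
Proof.
rewrite {1}/mmap rmorph_sum; apply: eq_bigr => k _.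
rewrite rmorphM; congr (_ * _); first exact: mmapC.
by rewrite /mmap1 rmorph_prod; apply: eq_bigr => u _; rewrite rmorphXn.
Qed.

Lemma mpolyXU_neq0 (K : fieldType) (N : nat) (u : 'I_N) : 'X_u != 0 :> {mpoly K[N]}.
Proof.
apply/eqP => /(congr1 (mcoeff U_(u))).
by rewrite mcoeffXU eqxx mcoeff0 => /eqP; rewrite oner_eq0.
Qed.

(** * Permanental ideals and their prime colons *)

(** The numbering [v] stays abstract so that transposing the matrix amounts to swapping the
    arguments of [v]. *)
Definition perm_gen (K : fieldType) (N m n : nat) (v : 'I_m -> 'I_n -> 'I_N)
    (i j : 'I_m) (k l : 'I_n) : {mpoly K[N]} :=
  'X_(v i k) * 'X_(v j l) + 'X_(v i l) * 'X_(v j k).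

(* The last field says that P is generated by the permanents; in this form it is invariant
   under transposition of v. *)
Record perm_ideal (K : fieldType) (N m n : nat) (v : 'I_m -> 'I_n -> 'I_N)
    (P : {pred {mpoly K[N]}}) : Prop := PermIdeal {
  perm_ideal0 : 0 \in P;
  perm_ideal_lin : forall a g h, g \in P -> h \in P -> a * g + h \in P;
  perm_ideal_gen : forall i j k l, i != j -> k != l -> perm_gen K v i j k l \in P;
  perm_ideal_ind : forall D : {mpoly K[N]} -> Prop, D 0 ->
    (forall g h, D g -> D h -> D (g + h)) ->
    (forall h i j k l, i != j -> k != l -> D (h * perm_gen K v i j k l)) ->
    forall g, g \in P -> D g }.

Lemma perm_ideal_tr (K : fieldType) (N m n : nat) (v : 'I_m -> 'I_n -> 'I_N)
    (P : {pred {mpoly K[N]}}) :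
  perm_ideal v P -> perm_ideal (fun j i => v i j) P.
Proof.
have e i j k l : perm_gen K (fun j i => v i j) i j k l = perm_gen K v k l i j.
  by rewrite /perm_gen; ring.
case=> P0 Pl Pg Pi; split => //.
- by move=> i j k l ij kl; rewrite e Pg.
- by move=> D D0 DD Dg; apply: Pi => // h i j k l ij kl; rewrite -e; apply: Dg.
Qed.

Section PermIdeal.
Variables (K : fieldType) (N m n : nat) (v : 'I_m -> 'I_n -> 'I_N).
Variable P : {pred {mpoly K[N]}}.
Hypothesis K2 : 2%:R != 0 :> K.
Hypothesis v_inj : forall i j k l, v i j = v k l -> i = k /\ j = l.
Hypothesis v_surj : forall u, exists i j, u = v i j.
Hypothesis P_ideal : perm_ideal v P.

Local Notation x i j := ('X_(v i j) : {mpoly K[N]}).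

Lemma v_eq i j k l : (v i j == v k l) = (i == k) && (j == l).
Proof.
apply/eqP/andP => [/v_inj[-> ->]//|[/eqP-> /eqP->]//].
Qed.

Lemma perm_idealM a g : g \in P -> a * g \in P.
Proof.
by move=> gP; rewrite -[_ * _]addr0 (perm_ideal_lin P_ideal) ?(perm_ideal0 P_ideal).
Qed.

Lemma perm_idealD g h : g \in P -> h \in P -> g + h \in P.
Proof. by move=> gP hP; rewrite -[g]mul1r (perm_ideal_lin P_ideal). Qed.

Lemma perm_ideal_sum (I : Type) (r : seq I) (Q : pred I) (F : I -> {mpoly K[N]}) :
  (forall i, Q i -> F i \in P) -> \sum_(i <- r | Q i) F i \in P.
Proof.
by move=> h; elim/big_ind: _ => //; [exact: perm_ideal0 P_ideal|exact: perm_idealD].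
Qed.

(* This is where the characteristic assumption enters. *)
Lemma perm_ideal_half g : g *+ 2 \in P -> g \in P.
Proof.
move=> /(perm_idealM ((2%:R : K)^-1)%:MP).
by rewrite mul_mpolyC -scalerMnr scalerMnl -mulr_natr mulVf // scale1r.
Qed.

Lemma perm_ideal_rmorph (A : nzRingType) (phi : {rmorphism {mpoly K[N]} -> A}) :
  (forall i j k l, i != j -> k != l -> phi (perm_gen K v i j k l) = 0) ->
  forall g, g \in P -> phi g = 0.
Proof.
move=> h; apply: (perm_ideal_ind P_ideal) => [|g1 g2 e1 e2|g i j k l ij kl].
- exact: rmorph0.
- by rewrite rmorphD e1 e2 addr0.
- by rewrite rmorphM h ?mulr0.
Qed.

Lemma row_triple i i' j k l : i != i' -> j != k -> j != l -> k != l ->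
  x i j * x i k * x i' l \in P.
Proof.
move=> ii jk jl kl; apply: perm_ideal_half.
(* Each of the three column pairs gives a permanent, weighted by the entry of row [i] in the
   remaining column, with alternating signs. *)
have -> : (x i j * x i k * x i' l) *+ 2 =
    x i k * perm_gen K v i i' j l +
    ((- x i l) * perm_gen K v i i' j k + x i j * perm_gen K v i i' k l).
  by rewrite /perm_gen; ring.
by do !apply: perm_idealD; apply: perm_idealM; apply: perm_ideal_gen.
Qed.

(** [pick] recovers the position of a variable from its number, uniquely for injective [v]; the
    default 0 is reached only outside the image of [v]. *)
Definition vsub (E : 'I_m -> 'I_n -> {mpoly K[N]}) : {mpoly K[N]} -> {mpoly K[N]} :=
  mmap (@mpolyC N K) (fun u =>
    if [pick t : 'I_m * 'I_n | u == v t.1 t.2] is Some t then E t.1 t.2 else 0).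

HB.instance Definition _ E := GRing.RMorphism.on (vsub E).

Lemma vsubU E i j : vsub E (x i j) = E i j.
Proof.
rewrite /vsub mmapX mmap1U; case: pickP => [[a b] /=|/(_ (i, j))]; last by rewrite eqxx.
by move=> /eqP/v_inj[-> ->].
Qed.

Lemma restrict_vsub S E p :
  (forall i j, restrict S (E i j) = restrict S (x i j)) ->
  restrict S (vsub E p) = restrict S p.
Proof.
move=> h; rewrite restrict_mmap {2}/restrict; apply: eq_bigr => k _; congr (_ * _).
apply: mmap1_eq => u /=; have [i [j ->]] := v_surj u.
case: pickP => [[a b] /= /eqP/v_inj[<- <-]|/(_ (i, j))]; last by rewrite eqxx.
by rewrite h restrictU.
Qed.

Definition row_of i : pred 'I_N := fun u => [exists j, u == v i j].

Lemma row_ofE i a c : row_of i (v a c) = (a == i).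
Proof.
apply/existsP/eqP => [[j /eqP/v_inj[]//]|->]; by exists c.
Qed.

Lemma restrict_row_gen i0 i j k l : i != j ->
  restrict (row_of i0) (perm_gen K v i j k l) = 0.
Proof.
move=> ij; rewrite /perm_gen rmorphD !rmorphM /= !restrictU !row_ofE.
case: (eqVneq i i0) ij => [->|_] ij;
  by rewrite ?[j == _]eq_sym ?(negbTE ij) ?mul0r ?mulr0 addr0.
Qed.

(* The values of the ring morphism whose kernel is the minimal prime attached to the
   block of rows i, i' and columns j, k: an entry factors as (row factor) (column factor),
   up to the sign of one corner. *)
Definition block_val (i i' : 'I_m) (j k : 'I_n) (a : 'I_m) (c : 'I_n) :=
  if a == i then (if c == j then x i j else if c == k then x i k else 0)
  else if a == i' then
    (if c == j then x i j * x i' j else if c == k then - (x i k * x i' j) else 0)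
  else 0.

(** Both terms vanish unless the permanent is that of the block itself, where the sign on one corner
    makes them cancel. *)
Lemma block_val_gen i i' j k a b c d : a != b -> c != d ->
  vsub (block_val i i' j k) (perm_gen K v a b c d) = 0.
Proof.
move=> ab cd; rewrite /perm_gen rmorphD !rmorphM /= !vsubU /block_val.
have abF : (a == b) = false by exact: negbTE.
have cdF : (c == d) = false by exact: negbTE.
repeat match goal with
  |- context [if ?p == ?q then _ else _] =>
    case: (eqVneq p q) => ?; subst; rewrite ?eqxx in ab cd abF cdF => //
  end; ring.
Qed.


(** For an ideal [P], this is the elementwise form of: (P : f) is a proper prime ideal. *)
Definition prime_witness (f : {mpoly K[N]}) : Prop :=
  f \notin P /\ forall a b, a * b * f \in P -> (a * f \in P) || (b * f \in P).

(** * Vanishing of a low-degree witness on each row *)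

Section Witness.
Variable f : {mpoly K[N]}.
Hypothesis f_wit : prime_witness f.
Hypothesis f_deg : forall m, f@_m != 0 -> (mdeg m <= 2)%N.

Lemma rmorph_annihilated (A : idomainType) (phi : {rmorphism {mpoly K[N]} -> A}) g :
  (forall i j k l, i != j -> k != l -> phi (perm_gen K v i j k l) = 0) ->
  g * f \in P -> (phi g == 0) || (phi f == 0).
Proof.
move=> h gfP; rewrite -mulf_eq0 -rmorphM; apply/eqP.
exact: (perm_ideal_rmorph h gfP).
Qed.

Lemma row_vars_annihilate i i' j k l : i != i' -> j != k -> j != l -> k != l ->
  x i j * f \notin P -> x i k * f \notin P -> x i' l * f \in P.
Proof.
move=> ii jk jl kl hj hk.
have h : x i j * x i k * x i' l * f \in P.
  by rewrite mulrC; apply: perm_idealM; apply: row_triple.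
have := f_wit.2 _ _ h => /orP[|//] /f_wit.2.
by rewrite (negbTE hj) (negbTE hk).
Qed.

Lemma third (T : finType) (a b : T) : (3 <= #|T|)%N -> exists c, c != a /\ c != b.
Proof.
move=> hT; have /card_gt0P[c] : (0 < #|predC (pred2 a b)|)%N.
  rewrite -(ltn_add2l #|pred2 a b|) cardC addn0; apply: leq_trans hT.
  by rewrite card2; case: (a != b).
by rewrite !inE negb_or => /andP[ca cb]; exists c.
Qed.

Hypotheses (m3 : (3 <= m)%N) (n3 : (3 <= n)%N).

Lemma third_row (a b : 'I_m) : exists c, c != a /\ c != b.
Proof. by apply: third; rewrite card_ord. Qed.

Lemma third_col (a b : 'I_n) : exists c, c != a /\ c != b.
Proof. by apply: third; rewrite card_ord. Qed.

Lemma restrict_row_witness i : restrict (row_of i) f = 0.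
Proof.
apply/eqP; apply: contraT => nz.
(* As restriction to row [i] does not kill [f], its kernel contains (P : f); no variable of the row
   lies in that kernel. *)
have xi j : x i j * f \notin P.
  apply/negP => /(rmorph_annihilated (phi := restrict (row_of i))
    (fun _ _ c d ab _ => restrict_row_gen i c d ab)).
  by rewrite (negbTE nz) orbF /= restrictU row_ofE eqxx (negbTE (mpolyXU_neq0 _ _)).
have xo k l : k != i -> x k l * f \in P.
  move=> ki; have [j [jl _]] := third_col l l; have [j' [jl' jj]] := third_col l j.
  by apply: (@row_vars_annihilate i k j j' l) => //; rewrite eq_sym.
have [i' [ii _]] := third_row i i.
have f0 j k m0 : j != k -> mnm_in (pred2 (v i j) (v i k)) m0 -> f@_m0 = 0.
  move=> jk hm; pose S := pred2 (v i j) (v i k).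
  (* [x i' j] lies in (P : f) but has the nonzero image [x i j * x i' j], so the block morphism must
     kill [f]. *)
  have /orP[] := rmorph_annihilated (phi := vsub (block_val i i' j k))
    (block_val_gen i i' j k) (xo i' j ii).
    rewrite /= vsubU /block_val (negbTE ii) !eqxx mulf_eq0.
    by rewrite !(negbTE (mpolyXU_neq0 _ _)).
  (* The block morphism fixes [x i j] and [x i k], and the images of all other entries restrict to
     0; hence it does not change the restriction to [S]. *)
  move=> /eqP e; have : (restrict S f)@_m0 = 0.
    rewrite -(restrict_vsub (E := block_val i i' j k)) ?e ?rmorph0 ?mcoeff0 //.
    move=> a c; rewrite /block_val; case: (eqVneq a i) => [->|ai].
      case: (eqVneq c j) => [-> //|cj]; case: (eqVneq c k) => [-> //|ck].
      by rewrite rmorph0 restrictU /S /= !v_eq (negbTE cj) (negbTE ck) !andbF.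
    have z b : restrict S (x i' b) = 0.
      by rewrite restrictU /S /= !v_eq (negbTE ii).
    rewrite [RHS]restrictU /S /= !v_eq (negbTE ai) /=.
    by repeat case: ifP => _; rewrite ?rmorphN ?rmorphM /= ?z ?mulr0 ?oppr0 ?rmorph0.
  by rewrite mcoeff_restrict hm.
suff z : restrict (row_of i) f = 0 by rewrite z eqxx in nz.
apply/mpolyP => m0; rewrite mcoeff0 mcoeff_restrict; case: mnm_inP => // hrow.
apply/eqP; apply: contraT => /[dup] fm /f_deg hd.
have [j0 _] := third_col (Ordinal (ltnW (ltnW n3))) (Ordinal (ltnW (ltnW n3))).
have [u [w huw]] := mnm_deg_le2 (v i j0) hd.
have [[a [b eu]] [c [d ew]]] := (v_surj u, v_surj w).
(* [f0] needs two distinct columns: [e] is [d], or any other column when [d = b]. *)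
have [e [eb hdbe]] : exists e, e != b /\ (d == b) || (d == e).
  case: (eqVneq d b) => [db|db]; last by exists d; rewrite db eqxx.
  by have [e [eb _]] := third_col b b; exists e.
have bfe : b != e by rewrite eq_sym.
case/eqP: fm; apply: (f0 _ _ _ bfe); apply/mnm_inP => t ht.
have /existsP[q /eqP et] := hrow _ ht.
move: (huw _ ht); rewrite et eu ew /= !v_eq !eqxx /=.
case/orP=> /andP[_ /eqP->]; first by rewrite eqxx.
by [].
Qed.

End Witness.

End PermIdeal.

Lemma mcoeffMX_le (K : fieldType) (N : nat) (g : {mpoly K[N]}) (a k : 'X_{1..N}) :
  (g * 'X_[a])@_k = if (a <= k)%MM then g@_(k - a) else 0.
Proof.
case: ifP => [ak|nak]; first by rewrite -[k in LHS](submK ak) addmC mcoeffMX.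
apply/eqP; rewrite mcoeff_eq0 (perm_mem (msuppMX _ _)).
by apply/mapP => -[k' _ ek]; rewrite ek lem_addr in nak.
Qed.

(** * The alternating form on permutation monomials *)

Section Skew.
Variables (K : fieldType) (N m n : nat) (v : 'I_m -> 'I_n -> 'I_N).
Variable P : {pred {mpoly K[N]}}.
Hypothesis v_inj : forall i j k l, v i j = v k l -> i = k /\ j = l.
Hypothesis P_ideal : perm_ideal v P.
Variables (d : nat) (r : 'I_d -> 'I_m) (c : 'I_d -> 'I_n).
Hypothesis c_inj : injective c.

(** The monomial of the Leibniz term of [s] in the submatrix with rows [r] and columns [c]. *)
Definition perm_mnm (s : 'S_d) : 'X_{1..N} := (\sum_t U_(v (r t) (c (s t))))%MM.

(* Modulo the ideal, exchanging two columns of a permutation monomial changes its sign. *)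
Definition skew (g : {mpoly K[N]}) : K :=
  \sum_(s : 'S_d) (-1) ^+ s * g@_(perm_mnm s).

Lemma perm_mnm_supp s i k :
  perm_mnm s (v i k) != 0%N -> exists2 t, r t = i & c (s t) = k.
Proof.
case: (pickP (fun t => (r t == i) && (c (s t) == k))) => [t /andP[/eqP rt /eqP ct] _|no].
  by exists t.
by rewrite /perm_mnm mnm_sumE big1 // => t _; rewrite mnm1E (v_eq v_inj) no.
Qed.

Lemma perm_mnm_le s i j k l :
  (U_(v i k) + U_(v j l) <= perm_mnm s)%MM ->
  (exists2 t, r t = i & c (s t) = k) /\ (exists2 t, r t = j & c (s t) = l).
Proof.
move=> /mnm_lepP h; split; apply: perm_mnm_supp; rewrite -lt0n;
  by apply: leq_trans (h _); rewrite mnmDE !mnm1E eqxx ?addn1.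
Qed.

Lemma perm_mnm_split s t t' : t != t' ->
  perm_mnm s = (U_(v (r t) (c (s t))) + U_(v (r t') (c (s t'))) +
    \sum_(t0 | (t0 != t) && (t0 != t')) U_(v (r t0) (c (s t0))))%MM.
Proof.
by move=> tt; rewrite /perm_mnm (bigD1 t) //= (bigD1 t') /= ?addmA // eq_sym.
Qed.

(** Exchanging columns [k] and [l] pairs permutations of opposite sign and swaps the two terms of
    the permanent, so the contributions cancel. *)
Lemma skew_perm_gen h i j k l : i != j -> k != l -> skew (h * perm_gen K v i j k l) = 0.
Proof.
move=> ij kl; pose T i j k l s : K :=
  if (U_(v i k) + U_(v j l) <= perm_mnm s)%MM
  then h@_(perm_mnm s - (U_(v i k) + U_(v j l))) else 0.
have -> : skew (h * perm_gen K v i j k l) =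
    \sum_(s : 'S_d) (-1) ^+ s * T i j k l s + \sum_(s : 'S_d) (-1) ^+ s * T i j l k s.
  rewrite -big_split; apply: eq_bigr => s _.
  by rewrite /perm_gen mulrDr mcoeffD -!mpolyXD !mcoeffMX_le mulrDr.
have T0 i1 j1 k1 l1 (s : 'S_d) : ~ (exists2 t, r t = i1 & c (s t) = k1) \/
    ~ (exists2 t, r t = j1 & c (s t) = l1) -> T i1 j1 k1 l1 s = 0.
  by rewrite /T; case: ifP => // /perm_mnm_le[? ?] [].
(* A column not selected by [c] meets no permutation monomial, so both sums vanish termwise. *)
case: (pickP (fun t => c t == k)) => [k' /eqP ck|nk]; last first.
  rewrite !big1 ?addr0 // => s _; rewrite T0 ?mulr0 //;
    [right|left] => -[t _ /eqP]; by rewrite nk.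
case: (pickP (fun t => c t == l)) => [l' /eqP cl|nl]; last first.
  rewrite !big1 ?addr0 // => s _; rewrite T0 ?mulr0 //;
    [left|right] => -[t _ /eqP]; by rewrite nl.
have kl' : k' != l' by apply: contraNneq kl => e; rewrite -ck -cl e.
rewrite [X in _ + X](reindex_inj (mulIg (tperm k' l'))) -big_split big1 //= => s _.
rewrite odd_permM odd_tperm kl' addbT signrN.
suff -> : T i j l k (s * tperm k' l')%g = T i j k l s by rewrite mulNr addrN.
pose t := (s^-1)%g k'; pose t' := (s^-1)%g l'.
have st : s t = k' by rewrite permKV.
have st' : s t' = l' by rewrite permKV.
have tt : t != t' by rewrite (inj_eq perm_inj).
have sE t0 : c (s t0) = k -> t0 = t.
  by move=> e; apply: (@perm_inj _ s); apply: c_inj; rewrite st ck.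
have sE' t0 : c (s t0) = l -> t0 = t'.
  by move=> e; apply: (@perm_inj _ s); apply: c_inj; rewrite st' cl.
have pE t0 : c ((s * tperm k' l')%g t0) = l -> t0 = t.
  move=> e; apply: (@perm_inj _ (s * tperm k' l')%g); apply: c_inj.
  by rewrite e permM st tpermL cl.
have pE' t0 : c ((s * tperm k' l')%g t0) = k -> t0 = t'.
  move=> e; apply: (@perm_inj _ (s * tperm k' l')%g); apply: c_inj.
  by rewrite e permM st' tpermR ck.
case: (eqVneq (r t) i) => [rt|nrt]; last first.
  by rewrite !T0 //; left => -[t0 rt0 e]; case/eqP: nrt;
    rewrite -rt0 -?(sE _ e) -?(pE _ e).
case: (eqVneq (r t') j) => [rt'|nrt]; last first.
  by rewrite !T0 //; right => -[t0 rt0 e]; case/eqP: nrt;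
    rewrite -rt0 -?(sE' _ e) -?(pE' _ e).
(* Once the entries at [t] and [t'] are divided out, both permutations leave the same monomial. *)
rewrite /T !(perm_mnm_split _ tt) !permM st st' tpermL tpermR ck cl rt rt'.
rewrite !lem_addr ![(_ + _ + _)%MM]addmC !addmK; congr (h@_ _).
apply: eq_bigr => t0 /andP[t0t t0t']; rewrite permM tpermD //.
  by rewrite -st (inj_eq perm_inj) eq_sym.
by rewrite -st' (inj_eq perm_inj) eq_sym.
Qed.

Lemma skew_perm_ideal g : g \in P -> skew g = 0.
Proof.
move: g; apply: (perm_ideal_ind P_ideal) => [|g1 g2 e1 e2|h i j k l].
- by rewrite /skew big1 // => s _; rewrite mcoeff0 mulr0.
- rewrite -[RHS]addr0 -{1}e1 -e2 /skew -big_split /=.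
  by apply: eq_bigr => s _; rewrite mcoeffD mulrDr.
- exact: skew_perm_gen.
Qed.

End Skew.

Section Skew3.
Variables (K : fieldType) (N m n : nat) (v : 'I_m -> 'I_n -> 'I_N).
Variable P : {pred {mpoly K[N]}}.
Hypothesis v_inj : forall i j k l, v i j = v k l -> i = k /\ j = l.
Hypothesis P_ideal : perm_ideal v P.

(** In the alternating form of ['X_(v i3 j3) * f], only permutations fixing the third index
    contribute: the identity and one transposition, with opposite signs. *)
Lemma minor_coeff_eq f i1 i2 i3 j1 j2 j3 :
  uniq [:: i1; i2; i3] -> uniq [:: j1; j2; j3] ->
  'X_(v i3 j3) * f \in P ->
  f@_(U_(v i1 j1) + U_(v i2 j2)) = f@_(U_(v i1 j2) + U_(v i2 j1)).
Proof.
move=> ui uj xfP.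
pose r := tnth [tuple i1; i2; i3]; pose c := tnth [tuple j1; j2; j3].
have r_inj : injective r by apply/tuple_uniqP.
have c_inj : injective c by apply/tuple_uniqP.
have := skew_perm_ideal v_inj P_ideal r c_inj xfP.
pose o0 := @Ordinal 3 0 isT; pose o1 := @Ordinal 3 1 isT; pose o2 := @Ordinal 3 2 isT.
rewrite /skew (bigD1 1%g) //= (bigD1 (tperm o0 o1)) /=; last first.
  by apply/eqP => /permP/(_ o0); rewrite tpermL perm1.
have E s : perm_mnm v r c s =
    (U_(v i1 (c (s o0))) + U_(v i2 (c (s o1))) + U_(v i3 (c (s o2))))%MM.
  rewrite /perm_mnm !big_ord_recl big_ord0 addm0 addmA.
  have -> : lift ord0 ord0 = o1 by apply: val_inj.
  have -> : lift ord0 (lift ord0 ord0) = o2 by apply: val_inj.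
  by have -> : ord0 = o0 by apply: val_inj.
have xE s : ('X_(v i3 j3) * f)@_(perm_mnm v r c s) =
    if s o2 == o2 then f@_(U_(v i1 (c (s o0))) + U_(v i2 (c (s o1)))) else 0.
  rewrite mulrC mcoeffMX_le; case: (eqVneq (s o2) o2) => [so|so].
    by rewrite E so lem_addl addmK.
  case: ifP => // /mnm_lepP/(_ (v i3 j3)); rewrite mnm1E eqxx lt0n.
  move=> /(perm_mnm_supp v_inj)[t rt ct]; case/eqP: so.
  have t2 : t = o2 by apply: r_inj.
  by rewrite -{1}t2; apply: c_inj.
rewrite big1 ?addr0; last first.
  move=> s /andP[s1 s01]; rewrite xE; case: eqP => [so|_]; last by rewrite mulr0.
  have ordE (t : 'I_3) : [\/ t = o0, t = o1 | t = o2].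
    case: t => [[|[|[|]]]] // h;
      [constructor 1|constructor 2|constructor 3]; exact: val_inj.
  have n2 t : t != o2 -> s t <> o2.
    by move=> to2 st; rewrite -so in st; move/perm_inj: st to2 => ->; rewrite eqxx.
  case: (ordE (s o0)) (ordE (s o1)) => [e0|e0|/(n2 o0 isT)//] [e1|e1|/(n2 o1 isT)//].
  - by have /perm_inj : s o0 = s o1 by rewrite e0 e1.
  - by case/eqP: s1; apply/permP => t; rewrite perm1; case: (ordE t) => ->.
  - case/eqP: s01; apply/permP => t; case: (ordE t) => ->; rewrite ?tpermL ?tpermR //.
    by rewrite tpermD.
  - by have /perm_inj : s o0 = s o1 by rewrite e0 e1.
rewrite !xE !perm1 tpermL tpermR tpermD // eqxx odd_perm1 odd_tperm expr0 expr1.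
by rewrite mul1r mulN1r => /eqP; rewrite subr_eq0 => /eqP.
Qed.

End Skew3.

(** * No prime colon in degree at most two *)

Section LowDegree.
Variables (K : fieldType) (N m n : nat) (v : 'I_m -> 'I_n -> 'I_N).
Variables (P : {pred {mpoly K[N]}}) (f : {mpoly K[N]}).
Hypothesis K2 : 2%:R != 0 :> K.
Hypothesis v_inj : forall i j k l, v i j = v k l -> i = k /\ j = l.
Hypothesis v_surj : forall u, exists i j, u = v i j.
Hypothesis P_ideal : perm_ideal v P.
Hypothesis f_wit : prime_witness P f.
Hypothesis f_deg : forall k, f@_k != 0 -> (mdeg k <= 2)%N.
Hypotheses (m3 : (3 <= m)%N) (n3 : (3 <= n)%N).

Local Notation x i j := ('X_(v i j) : {mpoly K[N]}).
Local Notation diag a b c d := (U_(v a c) + U_(v b d))%MM.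

Lemma restrict_col_witness j : restrict (row_of (fun b a => v a b) j) f = 0.
Proof.
apply: (restrict_row_witness K2 _ _ (perm_ideal_tr P_ideal) f_wit f_deg) => //.
- by move=> a b c d /v_inj[-> ->].
- by move=> u; have [a [b ->]] := v_surj u; exists b, a.
Qed.

(** Restrictions of [f] to rows and columns vanish, so the monomial lies in no single row or column;
    in degree at most 2 this leaves only such products. *)
Lemma witness_diag k : f@_k != 0 ->
  exists a b c d, [/\ a != b, c != d & k = diag a b c d].
Proof.
move=> fk; have hd := f_deg fk.
have row_out i : ~~ mnm_in (row_of v i) k.
  apply: contra fk => h; have /(congr1 (mcoeff k)) :=
    restrict_row_witness K2 v_inj v_surj P_ideal f_wit f_deg m3 n3 i.
  by rewrite mcoeff_restrict h mcoeff0 => ->.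
have col_out j : ~~ mnm_in (row_of (fun b a => v a b) j) k.
  apply: contra fk => h; have /(congr1 (mcoeff k)) := restrict_col_witness j.
  by rewrite mcoeff_restrict h mcoeff0 => ->.
have v_inj' i j i1 j1 : v j i = v j1 i1 -> i = i1 /\ j = j1 by move=> /v_inj[-> ->].
have colE j a c : row_of (fun b a => v a b) j (v a c) = (c == j).
  exact: (row_ofE v_inj').
have [u [w huw]] := mnm_deg_le2 (v (Ordinal (ltnW (ltnW m3))) (Ordinal (ltnW (ltnW n3)))) hd.
have [[a [c eu]] [b [d ew]]] := (v_surj u, v_surj w); rewrite eu ew in huw.
have ku : k (v a c) != 0%N.
  apply: contra (row_out b) => /eqP ku; apply/mnm_inP => t kt.
  by have /orP[] := huw _ kt => /eqP et; move: kt; rewrite et ?ku // (row_ofE v_inj).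
have kw : k (v b d) != 0%N.
  apply: contra (row_out a) => /eqP kw; apply/mnm_inP => t kt.
  by have /orP[] := huw _ kt => /eqP et; move: kt; rewrite et ?kw // (row_ofE v_inj).
have ab : a != b.
  apply: contra (row_out b) => /eqP ab; apply/mnm_inP => t kt.
  by case/orP: (huw _ kt) => /eqP->; rewrite (row_ofE v_inj) ?ab.
have cd : c != d.
  apply: contra (col_out d) => /eqP cd; apply/mnm_inP => t kt.
  by case/orP: (huw _ kt) => /eqP->; rewrite colE ?cd.
exists a, b, c, d; split=> //; apply: mnm_deg2 => //.
by rewrite (v_eq v_inj) (negbTE ab).
Qed.

(** By [witness_diag] only the two diagonals of the block survive, and the sign of the corner sends
    them to opposite monomials. *)
Lemma vsub_block_witness i i' j k : i != i' -> j != k ->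
  vsub v (block_val K v i i' j k) f =
  (f@_(diag i i' k j) - f@_(diag i i' j k)) *: (x i j * x i k * x i' j).
Proof.
move=> ii jk.
have fE k0 : f@_k0 = \sum_(k1 <- msupp f) f@_k1 * (k1 == k0)%:R.
  rewrite {1}(mpolyE f) raddf_sum; apply: eq_bigr => k1 _ /=.
  by rewrite mcoeffZ mcoeffX.
rewrite (fE (diag i i' k j)) (fE (diag i i' j k)) -sumrB scaler_suml.
rewrite /vsub /mmap !big_seq; apply: eq_bigr => k1.
rewrite mcoeff_msupp => /witness_diag[a [b [c [d [ab cd ek]]]]].
rewrite -(mmapX _ (@mpolyC N K)) -/(vsub v _ _) mul_mpolyC -mulrBr -scalerA; congr (_ *: _).
rewrite ek mpolyXD rmorphM /= !(vsubU v_inj) !mnm1D_eq ?(v_eq v_inj) ?(negbTE ii) //.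
rewrite /block_val.
have abF : (a == b) = false by exact: negbTE.
have cdF : (c == d) = false by exact: negbTE.
have iiF : (i == i') = false by exact: negbTE.
have iiF' : (i' == i) = false by rewrite eq_sym.
have jkF : (j == k) = false by exact: negbTE.
have jkF' : (k == j) = false by rewrite eq_sym.
repeat match goal with
  |- context [?p == ?q] =>
    case: (eqVneq p q) => ?; subst;
    rewrite ?eqxx in ab cd ii jk abF cdF iiF iiF' jkF jkF' => //=
  end;
rewrite ?subr0 ?sub0r ?subrr ?scale0r ?scaleN1r ?scale1r ?mulr0 ?mul0r //; ring.
Qed.

Lemma witness_coeff_eq i i' j k : i != i' -> j != k ->
  f@_(diag i i' j k) = f@_(diag i i' k j).
Proof.
move=> ii jk; apply/eqP; apply: contraT => ne.
have nz : vsub v (block_val K v i i' j k) f != 0.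
  rewrite vsub_block_witness // scaler_eq0 subr_eq0 eq_sym (negbTE ne) /=.
  by rewrite !mulf_eq0 !(negbTE (mpolyXU_neq0 _ _)).
(* Both entries have nonzero image under a morphism whose kernel contains (P : f). *)
have xn c : (c == j) || (c == k) -> x i c * f \notin P.
  move=> hc; apply/negP => /(rmorph_annihilated P_ideal
    (phi := vsub v (block_val K v i i' j k)) (block_val_gen K v_inj i i' j k)).
  rewrite (negbTE nz) orbF /= (vsubU v_inj) /block_val eqxx.
  case/orP: hc => /eqP->; rewrite eqxx; [|case: ifP => _];
    by rewrite (negbTE (mpolyXU_neq0 _ _)).
(* A row and a column outside the block complete it to a 3x3 submatrix whose corner [x i2 j2] lies
   in (P : f). *)
have [i2 [i2i i2i']] := third_row m3 i i'; have [j2 [j2j j2k]] := third_col n3 j k.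
have xP : x i2 j2 * f \in P.
  apply: (row_vars_annihilate K2 P_ideal f_wit (i := i) (j := j) (k := k)) => //;
    rewrite ?xn ?eqxx ?orbT //;
    by rewrite eq_sym.
move: ne; rewrite (minor_coeff_eq v_inj P_ideal _ _ xP) ?eqxx //= !inE.
  by rewrite negb_or ii !andbT eq_sym i2i eq_sym i2i'.
by rewrite negb_or jk !andbT eq_sym j2j eq_sym j2k.
Qed.

Local Notation quad := (('I_m * 'I_m) * ('I_n * 'I_n))%type.
Local Notation generic_quad t := ((t.1.1 != t.1.2) && (t.2.1 != t.2.2)).

(** Each monomial is listed twice, by (a, b; c, d) and by (b, a; d, c), whence the factor 2. *)
Lemma witness_double :
  f *+ 2 = \sum_(t : quad | generic_quad t)
     f@_(diag t.1.1 t.1.2 t.2.1 t.2.2) *: (x t.1.1 t.2.1 * x t.1.2 t.2.2).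
Proof.
apply/mpolyP => k; rewrite raddf_sum mcoeffMn /=.
under eq_bigr => t _ do rewrite mcoeffZ -mpolyXD mcoeffX.
have -> : \sum_(t : quad | generic_quad t) f@_(diag t.1.1 t.1.2 t.2.1 t.2.2) *
      (diag t.1.1 t.1.2 t.2.1 t.2.2 == k)%:R =
    f@_k * (\sum_(t : quad | generic_quad t) (diag t.1.1 t.1.2 t.2.1 t.2.2 == k))%:R.
  rewrite natr_sum mulr_sumr; apply: eq_bigr => t _.
  by case: (eqVneq (diag t.1.1 t.1.2 t.2.1 t.2.2) k) => [->|]; rewrite ?mulr0.
have [->|/witness_diag[a [b [c [d [ab cd ->]]]]]] := eqVneq (f@_k) 0.
  by rewrite mul0rn mul0r.
have vv : v a c != v b d by rewrite (v_eq v_inj) (negbTE ab).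
rewrite (bigD1 ((a, b), (c, d))) /=; last by rewrite ab cd.
rewrite (bigD1 ((b, a), (d, c))) /=; last first.
  by rewrite [b == a]eq_sym [d == c]eq_sym ab cd /= !xpair_eqE [b == a]eq_sym (negbTE ab).
rewrite big1 ?addn0.
  by rewrite eqxx addmC eqxx mulr_natr.
case=> [[a1 b1] [c1 d1]] /= /andP[/andP[_ n1] n2].
move: n1 n2; rewrite !xpair_eqE mnm1D_eq // !(v_eq v_inj) => n1 n2.
apply/eqP; rewrite eqb0 negb_or.
apply/andP; split; [apply: contra n1|apply: contra n2];
  by case/andP=> /andP[-> ->] /andP[-> ->].
Qed.

Lemma low_degree_witness_absurd : False.
Proof.
case: f_wit => /negP fP _; apply: fP.
do 2!apply: (perm_ideal_half K2 P_ideal).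
rewrite mulr2n {1}witness_double witness_double.
(* In 4f = 2f + 2f, exchanging the columns in the second copy pairs the two diagonals of each block;
   their equal coefficients leave a multiple of a permanent. *)
pose swap (t : quad) : quad := (t.1, (t.2.2, t.2.1)).
have swapK : involutive swap by case=> [? []].
rewrite [X in _ + X](reindex_inj (inv_inj swapK)) /=.
rewrite [X in _ + X](eq_bigl (fun t : quad => generic_quad t)); last first.
  by move=> t; rewrite [t.2.2 == _]eq_sym.
rewrite -big_split; apply: (perm_ideal_sum P_ideal) => t /andP[t1 t2] /=.
rewrite -(witness_coeff_eq t1 t2) -scalerDr -mul_mpolyC.
by apply: (perm_idealM P_ideal); apply: (perm_ideal_gen P_ideal).
Qed.

End LowDegree.

(** * A prime colon in degree three *)

Section RowWitness.
Variables (K : fieldType) (N m n : nat) (v : 'I_m -> 'I_n -> 'I_N).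
Variable P : {pred {mpoly K[N]}}.
Hypothesis K2 : 2%:R != 0 :> K.
Hypothesis v_inj : forall i j k l, v i j = v k l -> i = k /\ j = l.
Hypothesis v_surj : forall u, exists i j, u = v i j.
Hypothesis P_ideal : perm_ideal v P.
Variables (i : 'I_m) (j1 j2 j3 : 'I_n).
Hypothesis uniq_j : uniq [:: j1; j2; j3].

Local Notation f := ('X_(v i j1) * 'X_(v i j2) * 'X_(v i j3) : {mpoly K[N]}).

(** Column [b] is at most one of [j1], [j2], [j3]; two factors of the row monomial avoid it, and
    [row_triple] applies. *)
Lemma row_monomial_outer a b : a != i -> 'X_(v a b) * f \in P.
Proof.
move=> ai; have ia : i != a by rewrite eq_sym.
move: uniq_j; rewrite /= !inE negb_or andbT => /andP[/andP[n12 n13] n23].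
have T := row_triple K2 P_ideal ia.
case: (eqVneq b j3) => [->|b3].
  rewrite (_ : _ * _ = 'X_(v i j3) * ('X_(v i j1) * 'X_(v i j2) * 'X_(v a j3))); last ring.
  by apply: (perm_idealM P_ideal); apply: T.
case: (eqVneq b j2) => [->|b2].
  rewrite (_ : _ * _ = 'X_(v i j2) * ('X_(v i j1) * 'X_(v i j3) * 'X_(v a j2))); last ring.
  by apply: (perm_idealM P_ideal); apply: T; rewrite // eq_sym.
rewrite (_ : _ * _ = 'X_(v i j1) * ('X_(v i j2) * 'X_(v i j3) * 'X_(v a b))); last ring.
by apply: (perm_idealM P_ideal); apply: T; rewrite // eq_sym.
Qed.

(** Restriction to the row kills [P] and fixes the nonzero monomial. Conversely, if it kills [g],
    every term of [g] has a variable outside the row. *)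
Lemma colon_row_monomial g :
  (g * f \in P) = (restrict (row_of v i) g == 0).
Proof.
apply/idP/eqP => [gfP|g0].
  have := perm_ideal_rmorph P_ideal (phi := restrict (row_of v i))
    (fun _ _ c d ab _ => restrict_row_gen K v_inj i c d ab) gfP.
  rewrite !rmorphM /= !restrictU !(row_ofE v_inj) eqxx => /eqP.
  by rewrite !mulf_eq0 !(negbTE (mpolyXU_neq0 _ _)) !orbF => /eqP.
rewrite (mpolyE g) mulr_suml big_seq; apply: (perm_ideal_sum P_ideal) => k.
rewrite mcoeff_msupp => gk.
have : ~~ mnm_in (row_of v i) k.
  apply: contra gk => h; move/(congr1 (mcoeff k)): g0.
  by rewrite mcoeff_restrict h mcoeff0 => ->.
rewrite negb_forall => /existsP[u]; rewrite negb_imply => /andP[ku].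
have [a [b eu]] := v_surj u; rewrite eu (row_ofE v_inj) => ai.
have le : (U_(v a b) <= k)%MM.
  by apply/mnm_lepP => w; rewrite mnm1E -eu; case: eqVneq => // <-; rewrite lt0n.
rewrite -[in 'X_[k]](submK le) mpolyXD -mul_mpolyC -!mulrA.
by do 2!apply: (perm_idealM P_ideal); rewrite [X in _ * X]mulrA; apply: row_monomial_outer.
Qed.

End RowWitness.

(** * The generic matrix and its v-number *)

Lemma permanental_ideal2P (K : fieldType) (m n : nat) :
  perm_ideal (@mxvec_index m n) (permanental_ideal2 (generic_matrix K m n)).
Proof.
set I := permanental_ideal2 _.
have I0 : 0 \in I.
  by apply/boolp.asboolP; exists (fun=> 0); rewrite big1 // => t _; rewrite mul0r.
have Il a g h : g \in I -> h \in I -> a * g + h \in I.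
  move=> /boolp.asboolP[c ->] /boolp.asboolP[d ->]; apply/boolp.asboolP.
  exists (fun t => a * c t + d t); rewrite mulr_sumr -big_split.
  by apply: eq_bigr => t _; rewrite mulrDl mulrA.
have Xe i j : generic_matrix K m n i j = 'X_(mxvec_index i j) by rewrite mxE.
have gen (i j : 'I_m) (k l : 'I_n) : (i < j)%N -> (k < l)%N ->
    perm_gen K (@mxvec_index m n) i j k l \in I.
  move=> ij kl; apply/boolp.asboolP; exists (fun t => (t == ((i, j), (k, l)))%:R).
  rewrite (bigD1 ((i, j), (k, l))) /=; last by rewrite ij kl.
  rewrite eqxx mul1r big1 ?addr0 => [|t /andP[_ /negbTE->]]; last by rewrite mul0r.
  by rewrite /perm2 !Xe.
split=> //.
  move=> i j k l ij kl.
  (* Symmetry in rows and in columns reduces distinct indices to increasing ones. *)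
  have swap_row a b c d : perm_gen K (@mxvec_index m n) a b c d =
      perm_gen K (@mxvec_index m n) b a c d.
    by rewrite /perm_gen; ring.
  have swap_col a b c d : perm_gen K (@mxvec_index m n) a b c d =
      perm_gen K (@mxvec_index m n) a b d c.
    by rewrite /perm_gen; ring.
  have [lij|lji|/val_inj e] := ltngtP i j; last by rewrite e eqxx in ij.
    have [lkl|llk|/val_inj e] := ltngtP k l; last by rewrite e eqxx in kl.
      exact: gen.
    by rewrite swap_col; apply: gen.
  have [lkl|llk|/val_inj e] := ltngtP k l; last by rewrite e eqxx in kl.
    by rewrite swap_row; apply: gen.
  by rewrite swap_row swap_col; apply: gen.
move=> D D0 DD Dg g /boolp.asboolP[c ->]; elim/big_ind: _ => // t /andP[t1 t2].
have -> : perm2 (generic_matrix K m n) t.1.1 t.1.2 t.2.1 t.2.2 =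
    perm_gen K (@mxvec_index m n) t.1.1 t.1.2 t.2.1 t.2.2 by rewrite /perm2 !Xe.
by apply: Dg; rewrite -val_eqE neq_ltn ?t1 ?t2.
Qed.

Lemma mxvec_index_inj2 m n (i : 'I_m) (j : 'I_n) (k : 'I_m) (l : 'I_n) :
  mxvec_index i j = mxvec_index k l -> i = k /\ j = l.
Proof. by move=> /cast_ord_inj/enum_rank_inj[-> ->]. Qed.

Lemma mxvec_index_surj m n (u : 'I_(m * n)) :
  exists (i : 'I_m) (j : 'I_n), u = mxvec_index i j.
Proof. by case/mxvec_indexP: u => i j; exists i, j. Qed.

Theorem theorem3p6 (K : fieldType) (m n : nat)
    (charK : 2%N \notin [pchar K]%R)
    (hmn : (m <= n)%N) (hm : (3 <= m)%N) (hn : (3 <= n)%N) :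
  is_vnumber (permanental_ideal2 (generic_matrix K m n)) 3.
Proof.
have K2 : 2%:R != 0 :> K by move: charK; rewrite inE.
have P_ideal := permanental_ideal2P K m n.
have v_inj := @mxvec_index_inj2 m n; have v_surj := @mxvec_index_surj m n.
split.
  pose i := Ordinal (leq_trans (isT : 0 < 3)%N hm).
  pose j1 := Ordinal (leq_trans (isT : 0 < 3)%N hn).
  pose j2 := Ordinal (leq_trans (isT : 1 < 3)%N hn).
  pose j3 := Ordinal (leq_trans (isT : 2 < 3)%N hn).
  pose f : {mpoly K[m * n]} :=
    'X_(mxvec_index i j1) * 'X_(mxvec_index i j2) * 'X_(mxvec_index i j3).
  have colonE := @colon_row_monomial _ _ _ _ _ _ K2 v_inj v_surj P_ideal i j1 j2 j3 isT.
  (* The kernel of a ring morphism to a domain, hence prime. *)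
  pose p : {pred {mpoly K[m * n]}} :=
    [pred g | restrict (row_of (@mxvec_index m n) i) g == 0].
  have f_colon : colon (permanental_ideal2 (generic_matrix K m n)) f =i p.
    by move=> g; exact: colonE.
  exists f, p; split => //.
    by rewrite /f -!mpolyXD dhomogX /= !mdegD !mdeg1.
  split; last by exists f => g; rewrite f_colon.
  have inp g : (g \in p) = (restrict (row_of (@mxvec_index m n) i) g == 0) by [].
  split; last by move=> g h; rewrite !inp rmorphM mulf_eq0.
  split; rewrite ?inp ?rmorph0 ?rmorph1 ?oner_eq0 // => a g h.
  by rewrite !inp rmorphD rmorphM /= => /eqP-> /eqP->; rewrite mulr0 addr0.
move=> d [f [q [/dhomogP f_hom [[[q0 q1 ql] q_prime] _] qE]]].
rewrite leqNgt; apply/negP => d2.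
(* Properness of [q] gives that [f] is not in the ideal, and homogeneity bounds the degrees of its
   terms by 2. *)
apply: (low_degree_witness_absurd (f := f) K2 v_inj v_surj P_ideal _ _ hm hn).
  split=> [|a b]; first by move: q1; rewrite -qE inE mul1r.
  by have := q_prime a b; rewrite -!qE !inE.
by move=> k; rewrite -mcoeff_msupp => /f_hom ->.
Qed.
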